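(* Let $\mathbb{A}$ be any set of allowable test processes and let $\varphi\colon\mathbb{S}\to\mathcal{I}$ be any forecasting system. Then almost all paths are $\mathbb{A}$-random for $\varphi$ in the imprecise probability tree that corresponds to $\varphi$; that is, $\overline{P}^{\varphi}(\{\omega\in\Omega:\omega\text{ is not }\mathbb{A}\text{-random for }\varphi\})=0$. As a consequence, almost all paths are Schnorr random for $\varphi$ in the imprecise probability tree corresponding to $\varphi$; that is, $\overline{P}^{\varphi}(\{\omega\in\Omega:\omega\text{ is not Schnorr random for }\varphi\})=0$.
   Context: Notation: $\mathbb{N}=\{1,2,\dots\}$, $\mathbb{N}_0=\mathbb{N}\cup\{0\}$. Situations are the finite binary sequences $\mathbb{S}=\bigcup_{n\in\mathbb{N}_0}\{0,1\}^n$, with $\square$ the empty sequence; $sx$ is $s$ with $x\in\{0,1\}$ appended. Paths are elements $\omega$ of $\Omega=\{0,1\}^{\mathbb{N}}$; $\omega_{1:n}\in\mathbb{S}$ consists of the first $n$ entries. $\mathcal{I}$ is the set of non-empty closed subintervals of $[0,1]$. For $f\colon\{0,1\}\to\mathbb{R}$ and $I\in\mathcal{I}$, $\overline{E}_I(f)=\max_{p\in I}[pf(1)+(1-p)f(0)]$. A forecasting system is a map $\varphi\colon\mathbb{S}\to\mathcal{I}$. A real process is a map $F\colon\mathbb{S}\to\mathbb{R}$, with $\Delta F(s)(x)=F(sx)-F(s)$. A test process is a non-negative real process with $F(\square)=1$. A supermartingale for $\varphi$ is a real process $M$ with $\overline{E}_{\varphi(s)}(\Delta M(s))\le 0$ for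 all $s\in\mathbb{S}$; a test supermartingale for $\varphi$ is a test process that is a supermartingale for $\varphi$. For $A\subseteq\Omega$ with indicator $\mathbb{I}_A$, the upper probability is $$\overline{P}^{\varphi}(A)=\inf\{M(\square): M\text{ a supermartingale for }\varphi\text{ with }\liminf_{n\to\infty}M(\omega_{1:n})\ge\mathbb{I}_A(\omega)\text{ for all }\omega\in\Omega\}.$$ $A$ is null for $\varphi$ if $\overline{P}^{\varphi}(A)=0$; a property holds for almost all paths (almost surely) if it holds except perhaps on a null event. Computability: ''recursive'' means computable by a Turing machine (countable sets such as $\mathbb{S}$ and $\mathbb{S}\times\mathbb{N}_0$ are identified with $\mathbb{N}_0$ by recursive bijections with recursive inverse). A real process $F$ is computable if there are a recursive family of rationals $r_{s,n}$ and a recursive map $e\colon\mathbb{S}\times\mathbb{N}_0\to\mathbb{N}_0$ such that $n\ge e(s,N)$ implies $|r_{s,n}-F(s)|\le 2^{-N}$. A set of allowable test processes is any countable set $\mathbb{A}$ of test processes that contains all computable (strictly) positive test processes. A path $\omega$ is $\mathbb{A}$-random for $\varphi$ if $\sup_{n\in\mathbb{N}}T(\omega_{1:n})<\infty$ for every $T\in\mathbb{A}$ that is a test supermartingale for $\varphi$. A growth function is a recursive, non-decreasing, unbounded map $\rho\colon\mathbb{N}_0\to\mathbb{N}_0$. A path $\omega$ is Schnorr random for $\varphi$ if $\limsup_{n\to\infty}[T(\omega_{1:n})-\rho(n)]\le 0$ for all computable test supermartingales $T$ for $\varphi$ and all growth functions $\rho$. *)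

(* Defs.v *)
From HB Require Import structures.
From mathcomp Require Import all_boot all_order all_algebra.
From mathcomp Require Import all_classical all_reals all_analysis.

Set Implicit Arguments.
Unset Strict Implicit.
Unset Printing Implicit Defensive.

Import Order.TTheory GRing.Theory Num.Theory.

Local Open Scope classical_set_scope.
Local Open Scope ring_scope.

Definition situation := seq bool.

(* A path [w] lists its entries from index 0: [w i] is $\omega_{i+1}$. *)
Definition binary_path := nat -> bool.

Definition prefix_path (w : binary_path) (n : nat) : situation := mkseq w n.

(* Deterministic one-tape machines with finitely many states [0..tm_states]
   and tape symbols [0..tm_symbols.+1]; [tm_trans (q, a) = None] means that the
   machine halts, and in [Some (q', a', d)] the head writes [a'] and then moves
   right if [d] and left otherwise. *)
Record turing_machine := TuringMachine {
  tm_states : nat;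
  tm_symbols : nat;
  tm_trans : {ffun 'I_tm_states.+1 * 'I_tm_symbols.+2 ->
                option ('I_tm_states.+1 * 'I_tm_symbols.+2 * bool)}
}.

Definition tm_blank (M : turing_machine) : 'I_(tm_symbols M).+2 := ord0.

Definition tm_stroke (M : turing_machine) : 'I_(tm_symbols M).+2 :=
  @Ordinal (tm_symbols M).+2 1 isT.

(* The tape is infinite in both directions: [tm_left] is read from the head
   outwards, and cells beyond either list are blank. *)
Record tm_config (M : turing_machine) := TMConfig {
  tm_state : 'I_(tm_states M).+1;
  tm_left : seq 'I_(tm_symbols M).+2;
  tm_scanned : 'I_(tm_symbols M).+2;
  tm_right : seq 'I_(tm_symbols M).+2
}.

Definition tm_step (M : turing_machine) (c : tm_config M) :
    option (tm_config M) :=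
  match tm_trans M (tm_state c, tm_scanned c) with
  | None => None
  | Some (q, a, true) =>
      Some (TMConfig q (a :: tm_left c)
              (head (tm_blank M) (tm_right c)) (behead (tm_right c)))
  | Some (q, a, false) =>
      Some (TMConfig q (behead (tm_left c))
              (head (tm_blank M) (tm_left c)) (a :: tm_right c))
  end.

(* Input [n]: a block of [n] strokes whose leftmost cell is scanned. *)
Definition tm_init (M : turing_machine) (n : nat) : tm_config M :=
  let input := nseq n (tm_stroke M) in
  TMConfig ord0 [::] (head (tm_blank M) input) (behead input).

(* Output: the number of strokes on the tape. *)
Definition tm_output (M : turing_machine) (c : tm_config M) : nat :=
  count_mem (tm_stroke M) (tm_left c ++ tm_scanned c :: tm_right c).

Definition tm_computes (M : turing_machine) (n m : nat) : Prop :=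
  exists (t : nat) (c : tm_config M),
    [/\ iter t (obind (@tm_step M)) (Some (tm_init M n)) = Some c,
        tm_step c = None & tm_output c = m].

Definition recursive (f : nat -> nat) : Prop :=
  exists M : turing_machine, forall n : nat, tm_computes M n (f n).

(* Bijective binary numeration: code([::]) = 0, code(sx) = 2 code(s) + 1 + x. *)
Definition situation_code (s : situation) : nat :=
  foldl (fun (c : nat) (x : bool) => (c.*2 + x).+1) 0%N s.

(* Cantor's pairing (m + n)(m + n + 1)/2 + m. *)
Definition pair_code (p : nat * nat) : nat := ('C((p.1 + p.2).+1, 2) + p.1)%N.

Lemma situation_code_bij : bijective situation_code.
Proof.
have codeE s x : situation_code (rcons s x) = ((situation_code s).*2 + x).+1.
  by rewrite /situation_code foldl_rcons.
rewrite -setTT_bijective; split => //.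
- move=> s t _ _; elim/last_ind: s t => [|s x IH] t; elim/last_ind: t => [|t y _];
    rewrite ?codeE //.
  move=> [e].
  have exy : x = y.
    by have := congr1 odd e; rewrite !oddD !odd_double; case: (x); case: (y).
  by rewrite (IH t) ?exy //; move: e; rewrite exy => /addIn /double_inj.
- move=> n _ /=; suff [s sn] : exists s, situation_code s = n by exists s.
  elim/ltn_ind: n => -[|n] IH; first by exists [::].
  have [|s sn] := IH n./2.
    by rewrite ltnS -{2}(odd_double_half n) -addnn addnA leq_addl.
  by exists (rcons s (odd n)); rewrite codeE sn addnC odd_double_half.
Qed.

Lemma pair_code_bij : bijective pair_code.
Proof.
have lt_code m n m' n' : (m + n < m' + n')%N ->
    (pair_code (m, n) < pair_code (m', n'))%N.
  move=> lt; rewrite /pair_code /=.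
  apply: (@leq_trans 'C((m' + n').+1, 2)); last exact: leq_addr.
  apply: (@leq_trans 'C((m + n).+2, 2)); last exact: leq_bin2l.
  by rewrite (binS (m + n).+1 1) bin1 -addnS leq_add2l ltnS leq_addr.
rewrite -setTT_bijective; split => //.
- move=> [m n] [m' n'] _ _ e.
  have [lt|lt|s] := ltngtP (m + n)%N (m' + n')%N.
  + by have := lt_code _ _ _ _ lt; rewrite e ltnn.
  + by have := lt_code _ _ _ _ lt; rewrite e ltnn.
  move: e; rewrite /pair_code /= s => /addnI em.
  by move: s; rewrite em => /addnI ->.
- move=> k _ /=; suff [p pk] : exists p, pair_code p = k by exists p.
  elim: k => [|k [[m [|n]] <-]]; first by exists (0%N, 0%N).
    by exists (0%N, m.+1); rewrite /pair_code /= addn0 add0n (binS m.+1 1) bin1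
      addn0 addnS.
  by exists (m.+1, n); rewrite /pair_code /= addSnnS addnS.
Qed.

Definition recursive_sn (f : situation -> nat -> nat) : Prop :=
  exists g : nat -> nat, recursive g /\
    forall s n, f s n = g (pair_code (situation_code s, n)).

Definition recursive_rat_family (r : situation -> nat -> rat) : Prop :=
  exists a b sg : situation -> nat -> nat,
    [/\ recursive_sn a, recursive_sn b, recursive_sn sg &
        forall s n, (0 < b s n)%N /\
          r s n = (-1) ^+ sg s n * ((a s n)%:R / (b s n)%:R)].

Definition growth_function (rho : nat -> nat) : Prop :=
  [/\ recursive rho,
      {homo rho : m n / (m <= n)%N} &
      forall B : nat, exists n : nat, (B < rho n)%N].

Section ImpreciseTrees.
Variable R : realType.

(* Non-empty closed subintervals of [0, 1]. *)
Record prob_interval := ProbInterval {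
  pi_lo : R;
  pi_hi : R;
  _ : 0 <= pi_lo;
  _ : pi_lo <= pi_hi;
  _ : pi_hi <= 1
}.

Definition pi_set (I : prob_interval) : set R := `[pi_lo I, pi_hi I].

(* [sup] is a maximum here: a continuous function on a compact interval. *)
Definition upper_expectation (I : prob_interval) (f : bool -> R) : R :=
  sup [set p * f true + (1 - p) * f false | p in pi_set I].

Definition forecasting_system := situation -> prob_interval.

Definition real_process := situation -> R.

Definition delta (F : real_process) (s : situation) (x : bool) : R :=
  F (rcons s x) - F s.

Definition test_process (F : real_process) : Prop :=
  (forall s, 0 <= F s) /\ F [::] = 1.

Definition supermartingale (phi : forecasting_system) (M : real_process) :
    Prop :=
  forall s, upper_expectation (phi s) (delta M s) <= 0.

Definition test_supermartingale (phi : forecasting_system)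
    (T : real_process) : Prop :=
  test_process T /\ supermartingale phi T.

Definition along (F : real_process) (w : binary_path) (n : nat) : R :=
  F (prefix_path w n).

Definition upper_probability (phi : forecasting_system) (A : set binary_path) :
    \bar R :=
  ereal_inf [set (M [::])%:E | M in
    [set M : real_process | supermartingale phi M /\
      forall w : binary_path,
        ((\1_A w)%:E <= limn_einf (fun n => (along M w n)%:E))%E]].

Definition computable_process (F : real_process) : Prop :=
  exists (r : situation -> nat -> rat) (e : situation -> nat -> nat),
    [/\ recursive_rat_family r, recursive_sn e &
        forall s N n, (e s N <= n)%N ->
          `|ratr (r s n) - F s| <= 2 ^- N].

Definition allowable (AA : set real_process) : Prop :=
  [/\ countable AA,
      forall T, AA T -> test_process T &
      forall T, test_process T -> (forall s, 0 < T s) ->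
        computable_process T -> AA T].

Definition random (AA : set real_process) (phi : forecasting_system)
    (w : binary_path) : Prop :=
  forall T, AA T -> test_supermartingale phi T ->
    (ereal_sup [set (along T w n)%:E | n in [set n | (1 <= n)%N]] < +oo)%E.

Definition schnorr_random (phi : forecasting_system) (w : binary_path) : Prop :=
  forall (T : real_process) (rho : nat -> nat),
    computable_process T -> test_supermartingale phi T ->
    growth_function rho ->
    (limn_esup (fun n => (along T w n - (rho n)%:R)%:E) <= 0)%E.

End ImpreciseTrees.

(* Main.v *)
(** Given countably many test supermartingales [T_k] and [eps > 0], the capped
    mixtures [min 1 (\sum_(k < n) eps 2^-(k+1) T_k)] increase with [n] to a
    supermartingale that starts below [eps] and reaches [1] along every path on
    which some [T_k] is unbounded; freezing it once it reaches [1] makes its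
    limit inferior equal to [1] there.  The cap is needed because [T_k] may be
    arbitrarily large at a successor of probability [0], so that the mixture
    itself can be infinite.  Conversely no supermartingale with non-negative
    limit inferior starts below [0], since along some path it never increases.
    There are only countably many Turing machines, hence countably many
    computable processes, and a path that is not Schnorr random makes one of the
    computable test supermartingales unbounded. *)

Require Import Defs.
From mathcomp Require Import all_boot all_order all_algebra.
From mathcomp Require Import all_classical all_reals all_analysis.
Import Order.TTheory GRing.Theory Num.Theory.
Import numFieldNormedType.Exports.

Local Open Scope classical_set_scope.
Local Open Scope ring_scope.

(** * Bounds on limits inferior and superior; prefixes of paths *)

Lemma limn_einf_ge (R : realType) (u : (\bar R)^nat) (l : \bar R) :
  (\forall n \near \oo, (l <= u n)%E) -> (l <= limn_einf u)%E.
Proof.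
move=> [N _ lu]; rewrite limn_einf_lim; apply: lime_ge; first exact: is_cvg_einfs.
exists N => // n /= Nn; apply: le_ereal_inf_tmp => _ [m /= nm <-].
exact/lu/(leq_trans Nn).
Qed.

Lemma limn_esup_le (R : realType) (u : (\bar R)^nat) (l : \bar R) :
  (\forall n \near \oo, (u n <= l)%E) -> (limn_esup u <= l)%E.
Proof.
move=> [N _ ul]; rewrite limn_esup_lim; apply: lime_le; first exact: is_cvg_esups.
exists N => // n /= Nn; apply: ge_ereal_sup => _ [m /= nm <-].
exact/ul/(leq_trans Nn).
Qed.

Lemma prefix_rconsE (T : eqType) (t s : seq T) (x : T) :
  prefix t (rcons s x) = (t == rcons s x) || prefix t s.
Proof.
apply/idP/orP => [/prefixP[u]|[/eqP ->|ts]]; last 2 first.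
- exact: prefix_refl.
- exact: prefix_trans ts (prefix_rcons s x).
elim/last_ind: u => [|u y _]; first by rewrite cats0 => ->; left.
by rewrite -rcons_cat => /rcons_inj[-> _]; right; exact: prefix_prefix.
Qed.

Lemma prefix_pathS (w : binary_path) n :
  Defs.prefix_path w n.+1 = rcons (Defs.prefix_path w n) (w n).
Proof. by rewrite /Defs.prefix_path /mkseq -addn1 iotaD map_cat cats1. Qed.

Lemma prefix_prefix_path (w : binary_path) m n :
  (m <= n)%N -> prefix (Defs.prefix_path w m) (Defs.prefix_path w n).
Proof.
move=> /subnK <-.
by rewrite /Defs.prefix_path /mkseq addnC iotaD map_cat prefix_prefix.
Qed.

(** * Closure properties of supermartingales *)

Section Supermartingales.
Context {R : realType}.
Implicit Types (phi : forecasting_system R) (M T : real_process R).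

Lemma pi_set_ge0_le1 (I : prob_interval R) p : pi_set I p -> 0 <= p <= 1.
Proof.
case: I => lo hi lo0 lohi hi1; rewrite /pi_set /= in_itv /= => /andP[lop phi].
by rewrite (le_trans lo0 lop) (le_trans phi hi1).
Qed.

Lemma pi_set_lo (I : prob_interval R) : pi_set I (pi_lo I).
Proof. by case: I => lo hi lo0 lohi hi1; rewrite /pi_set /= in_itv /= lexx. Qed.

(** The set of averages is bounded and contains the one at [pi_lo I], so its [sup] is a genuine
    least upper bound and can be compared with [c] pointwise. *)
Lemma upper_expectation_le (I : prob_interval R) (f : bool -> R) (c : R) :
  upper_expectation I f <= c <->
  (forall p, pi_set I p -> p * f true + (1 - p) * f false <= c).
Proof.
split=> [fc p Ip|fc].
  apply: le_trans fc; apply: ub_le_sup; last by exists p.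
  exists (`|f true| + `|f false|) => _ [q /pi_set_ge0_le1/andP[q0 q1] <-].
  apply: lerD; apply: le_trans (ler_norm _) _; rewrite normrM ger0_norm ?subr_ge0 //.
    by rewrite ler_piMl.
  by rewrite ler_piMl // gerBl.
apply: ge_sup; first by eexists; exists (pi_lo I) => //; exact: pi_set_lo.
by move=> _ [p Ip <-]; exact: fc.
Qed.

(** The weights [p] and [1 - p] sum to one, so [M s] can be pulled out of the averaged increments.
    In this form the closure properties reduce to a fixed [p]. *)
Lemma supermartingaleP phi M : supermartingale phi M <->
  forall s p, pi_set (phi s) p ->
    p * M (rcons s true) + (1 - p) * M (rcons s false) <= M s.
Proof.
have e p a b c : (p * (a - c) + (1 - p) * (b - c) <= 0) =
    (p * a + (1 - p) * b <= c) :> bool.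
  rewrite -[RHS]subr_le0; congr (_ <= 0).
  by rewrite !mulrBr addrACA -opprD -mulrDl addrC subrKC mul1r addrC.
split=> H s.
  by move=> p Ip; rewrite -e; exact: (upper_expectation_le _ _ _).1 (H s) p Ip.
by apply/upper_expectation_le => p Ip; rewrite e; exact: H.
Qed.

Lemma supermartingale_cst phi (c : R) : supermartingale phi (fun=> c).
Proof. by apply/supermartingaleP => s p _; rewrite -mulrDl subrKC mul1r. Qed.

Lemma supermartingale_lincomb phi (I : Type) (r : seq I) (a : I -> R)
    (M : I -> real_process R) :
  (forall i, 0 <= a i) -> (forall i, supermartingale phi (M i)) ->
  supermartingale phi (fun s => \sum_(i <- r) a i * M i s).
Proof.
move=> a0 supM; apply/supermartingaleP => s p Ip.
rewrite !mulr_sumr -big_split /=; apply: ler_sum => i _.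
rewrite mulrCA [X in _ + X]mulrCA -mulrDr ler_wpM2l //.
by move/supermartingaleP: (supM i); apply.
Qed.

Lemma supermartingale_min phi M1 M2 :
  supermartingale phi M1 -> supermartingale phi M2 ->
  supermartingale phi (fun s => Num.min (M1 s) (M2 s)).
Proof.
move=> /supermartingaleP sup1 /supermartingaleP sup2.
apply/supermartingaleP => s p Ip; have /andP[p0 p1] := pi_set_ge0_le1 _ _ Ip.
rewrite le_min (le_trans _ (sup1 s p Ip)) ?(le_trans _ (sup2 s p Ip)) //;
  by apply: lerD; rewrite ler_wpM2l ?subr_ge0 // ge_min lexx ?orbT.
Qed.

(** A bounded nondecreasing sequence converges to its [sup], and for each fixed [p] the inequality
    passes to the limit. *)
Lemma supermartingale_sup phi (M : nat -> real_process R) :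
  (forall n, supermartingale phi (M n)) ->
  (forall s, nondecreasing_seq (M^~ s)) ->
  (forall s, has_ubound (range (M^~ s))) ->
  supermartingale phi (fun s => sup (range (M^~ s))).
Proof.
move=> supM ndM ubM; apply/supermartingaleP => s p Ip.
have cvgM s' := nondecreasing_cvgn (ndM s') (ubM s').
apply: ler_cvg_to (cvgM s) _.
  by apply: cvgD; apply: cvgMl_tmp; exact: cvgM.
by apply: nearW => n; move/supermartingaleP: (supM n); apply.
Qed.

(** A stopped process, held at the level [c] rather than at the value with which [M] crossed it. *)
Definition freeze (c : R) (M : real_process R) : real_process R := fun s =>
  if `[< exists2 t, prefix t s & c <= M t >] then c else M s.

(** Once [c] has been reached the process is constant. Before that it agrees with [M] at [s], and
    freezing can only lower the values at the successors. *)
Lemma supermartingale_freeze phi c M :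
  supermartingale phi M -> supermartingale phi (freeze c M).
Proof.
move=> /supermartingaleP supM; apply/supermartingaleP => s p Ip.
have /andP[p0 p1] := pi_set_ge0_le1 _ _ Ip.
rewrite {3}/freeze; case: asboolP => [[t ts ct]|nreach].
  have fc x : freeze c M (rcons s x) = c.
    rewrite /freeze asboolT //; exists t => //.
    by rewrite prefix_rconsE ts orbT.
  by rewrite !fc -mulrDl subrKC mul1r.
have fle x : freeze c M (rcons s x) <= M (rcons s x).
  rewrite /freeze; case: asboolP => // -[t].
  rewrite prefix_rconsE => /orP[/eqP -> //|ts ct].
  by case: nreach; exists t.
apply: le_trans (supM s p Ip).
by apply: lerD; rewrite ler_wpM2l ?subr_ge0.
Qed.

(** An average is at least the smaller of its two values, so every situation has a successor at
    which [M] does not increase; the path follows these successors. *)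
Lemma supermartingale_nonincreasing_path phi M : supermartingale phi M ->
  exists w, forall n, along M w n <= M [::].
Proof.
move=> /supermartingaleP supM.
have step s : {x | M (rcons s x) <= M s}.
  apply: cid; have := supM s _ (pi_set_lo (phi s)).
  have /andP[p0 p1] := pi_set_ge0_le1 _ _ (pi_set_lo (phi s)).
  set p := pi_lo _ in p0 p1 *.
  have [le1 _|gt1] := leP (M (rcons s true)) (M s); first by exists true.
  have [le0 _|gt0] := leP (M (rcons s false)) (M s); first by exists false.
  rewrite leNgt => /negP[].
  (* Writing [M s] as its own average allows a termwise comparison. Strictness comes from the first
     term if [0 < p], and from the second if [p = 0]. *)
  rewrite -[ltLHS]mul1r -[in ltLHS](subrKC p 1) mulrDl.
  have [p_gt0|] := ltP 0 p.
    by apply: ltr_leD; [rewrite ltr_pM2l|rewrite ler_wpM2l ?subr_ge0 // ltW].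
  move=> p_le0; have -> : p = 0 by apply/eqP; rewrite eq_le p_le0.
  by rewrite !mul0r subr0 !mul1r !add0r.
pose s := fix s n := if n is n'.+1 then rcons (s n') (sval (step (s n'))) else [::].
exists (fun n => sval (step (s n))).
have ws n : Defs.prefix_path (fun n => sval (step (s n))) n = s n.
  by elim: n => [//|n IH]; rewrite prefix_pathS IH.
elim=> [//|n]; apply: le_trans; rewrite /along !ws /=.
exact: (svalP (step (s n))).
Qed.

(** * Upper probability and the event of unboundedness *)

Lemma upper_probability_ge0 phi A : (0 <= upper_probability phi A)%E.
Proof.
apply: le_ereal_inf_tmp => _ [M [supM MA] <-].
have [w Mw] := supermartingale_nonincreasing_path _ _ supM.
apply: (@le_trans _ _ (\1_A w)%:E); first by rewrite lee_fin indicE ler0n.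
apply: le_trans (MA w) _; apply: (le_trans (limn_einf_sup _)).
by apply: limn_esup_le; apply: nearW => n; rewrite lee_fin.
Qed.

Lemma le_upper_probability phi A B :
  A `<=` B -> (upper_probability phi A <= upper_probability phi B)%E.
Proof.
move=> AB; apply: ereal_inf_le_tmp => _ [M [supM MB] <-]; exists M => //.
split=> // w; apply: le_trans (MB w).
rewrite lee_fin !indicE ler_nat.
by case: (boolP (w \in A)) => // /set_mem/AB/mem_set ->.
Qed.

Lemma upper_probability_unbounded phi (T : nat -> real_process R) :
  (forall k, test_supermartingale phi (T k)) ->
  upper_probability phi
    [set w | exists k, forall B, exists n, B < along (T k) w n] = 0%E.
Proof.
move=> testT; apply/eqP; rewrite eq_le upper_probability_ge0 andbT.
apply/lee_addgt0Pr => eps eps0; rewrite add0e.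
pose a k : R := eps * 2^-1 ^+ k.+1.
have a_gt0 k : 0 < a k by rewrite mulr_gt0 // exprn_gt0 // invr_gt0.
have sum_a n : \sum_(k < n) a k <= eps.
  suff -> : \sum_(k < n) a k = eps * (1 - 2^-1 ^+ n).
    by rewrite ler_piMr ?ltW // gerBl exprn_ge0 // invr_ge0.
  elim: n => [|n IH]; first by rewrite big_ord0 expr0 subrr mulr0.
  rewrite big_ord_recr /= IH -mulrDr; congr (_ * _).
  rewrite -addrA; congr (_ + _).
  rewrite [in LHS](splitr (2^-1 ^+ n)) exprS mulrC.
  by rewrite opprD addrNK.
pose M n s := Num.min 1 (\sum_(k < n) a k * T k s).
have T_ge0 k s : 0 <= T k s by have [[]] := testT k.
have M_ge0 n s : 0 <= M n s.
  by rewrite le_min ler01 sumr_ge0 // => k _; rewrite mulr_ge0 // ltW.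
have supM n : supermartingale phi (M n).
  apply: supermartingale_min; first exact: supermartingale_cst.
  apply: supermartingale_lincomb => k; first exact: ltW.
  by have [] := testT k.
have ndM s : nondecreasing_seq (M^~ s).
  apply/nondecreasing_seqP => n; rewrite le_min !ge_min lexx /=.
  by rewrite big_ord_recr /= lerDl mulr_ge0 ?orbT // ltW.
have ubM s : has_ubound (range (M^~ s)).
  by exists 1 => _ [n _ <-]; rewrite ge_min lexx.
pose L s := sup (range (M^~ s)).
have ML n s : M n s <= L s by apply: ub_le_sup => //; exists n.
have fL_ge0 s : 0 <= freeze 1 L s.
  by rewrite /freeze; case: ifP => // _; exact: le_trans (ML 0%N s).
apply: (@le_trans _ _ (freeze 1 L [::])%:E).
  apply: ereal_inf_lbound; exists (freeze 1 L) => //; split.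
    exact/supermartingale_freeze/supermartingale_sup.
  move=> w; apply: limn_einf_ge; rewrite indicE.
  case: (boolP (w \in _)) => [/set_mem[k Tk]|_]; last first.
    by apply: nearW => n; rewrite lee_fin; exact: fL_ge0.
  (* Above the threshold [(a k)^-1] the single term [a k * T k] exceeds [1], so [M k.+1], and with
     it [L], has reached [1] by time [m]. *)
  have [m mP] := Tk (a k)^-1.
  exists m => // n /= mn; rewrite lee_fin /along /freeze asboolT //.
  exists (Defs.prefix_path w m); first exact: prefix_prefix_path.
  apply: le_trans (ML k.+1 _); rewrite le_min lexx big_ord_recr /=.
  rewrite -[leLHS]add0r lerD ?sumr_ge0 // => [i _|].
    by rewrite mulr_ge0 // ltW.
  by rewrite mulrC -ler_pdivrMr // mul1r ltW.
have L_le : L [::] <= eps.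
  apply: ge_sup; first by eexists; exists 0%N.
  move=> _ [n _ <-]; rewrite ge_min; apply/orP; right.
  apply: le_trans (sum_a n); apply: ler_sum => k _.
  by have [[_ ->] _] := testT k; rewrite mulr1.
rewrite lee_fin /freeze; case: asboolP => // -[t].
by rewrite prefixs0 => /eqP -> /le_trans; apply.
Qed.

(** * Non-random paths for a countable set of processes *)

Lemma not_randomP (AA : set (real_process R)) phi w :
  ~ random AA phi w <-> exists T, [/\ AA T, test_supermartingale phi T &
    forall B, exists2 n, (1 <= n)%N & B < along T w n].
Proof.
split=> [|[T [AT testT unb]] /(_ T AT testT)].
  move=> /existsNP[T /not_implyP[AT /not_implyP[testT /negP]]].
  rewrite -leNgt => ub; exists T; split=> // B.
  have /ereal_sup_gtP[_ [n n1 <-]] := lt_le_trans (ltry B) ub.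
  by rewrite lte_fin; exists n.
case E : ereal_sup => [b| |] //.
  have [n n1] := unb b; rewrite ltNge -lee_fin -E => /negP[].
  by apply: ereal_sup_ubound; exists n.
(* The supremum is not [-oo] because the set of values is non-empty; unboundedness at level [0]
   supplies an index. *)
have [n n1 _] := unb 0.
suff : ((along T w n)%:E <= -oo)%E by [].
by rewrite -E; apply: ereal_sup_ubound; exists n.
Qed.

Lemma upper_probability_nonrandom phi (AA : set (real_process R)) :
  countable AA -> upper_probability phi [set w | ~ random AA phi w] = 0%E.
Proof.
move=> /countable_injP[f finj].
pose one : real_process R := fun=> 1.
(* Numbers [k] that code no test supermartingale in [AA] receive the constant process [1], which is
   a test supermartingale too. *)
pose T k := xget one [set T | [/\ AA T, test_supermartingale phi T & f T = k]].
have testT k : test_supermartingale phi (T k).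
  rewrite /T; case: xgetP => [_ _ []//|_].
  by split; [split|exact: supermartingale_cst].
apply/eqP; rewrite eq_le upper_probability_ge0 andbT.
rewrite -(upper_probability_unbounded phi T testT).
apply: le_upper_probability => w /= /not_randomP[T' [AT' testT' unb]].
exists (f T') => B; have [n _ Bn] := unb B; exists n.
suff -> : T (f T') = T' by [].
rewrite /T; case: xgetP => [T'' _ [AT'' _ /finj]|/(_ T')[]//].
by apply; rewrite inE.
Qed.

End Supermartingales.

(** * Countability of the recursive functions and computable processes *)

Definition transition_table (q : nat * nat) : Type :=
  {ffun 'I_q.1.+1 * 'I_q.2.+2 -> option ('I_q.1.+1 * 'I_q.2.+2 * bool)}.

(** A machine is repackaged as a dependent pair of its sizes and a table between finite types; this
    type is countable, so [pickle] is injective on it. *)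
Definition turing_machine_code (M : turing_machine) : nat :=
  pickle (existT transition_table (tm_states M, tm_symbols M) (tm_trans M)).

Lemma turing_machine_code_inj : injective turing_machine_code.
Proof.
pose decode (u : {q & transition_table q}) :=
  TuringMachine (projT2 u : {ffun _ -> _}).
move=> M N /(pcan_inj (@pickleK _))/(congr1 decode).
by case: M; case: N.
Qed.

(** A deterministic run has at most one halting configuration, since every iteration past it yields
    [None]. *)
Lemma tm_computes_inj M n m m' :
  tm_computes M n m -> tm_computes M n m' -> m = m'.
Proof.
have halted t t' c c' : (t < t')%N ->
    iter t (obind (@tm_step M)) (Some (tm_init M n)) = Some c ->
    tm_step c = None ->
    iter t' (obind (@tm_step M)) (Some (tm_init M n)) <> Some c'.
  move=> /subnK <- ct hc; rewrite iterD iterS ct /= hc.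
  by rewrite (_ : iter _ _ None = None) //; elim: (_ - _)%N => //= k ->.
move=> [t [c [ct hc <-]]] [t' [c' [ct' hc' <-]]].
have [tt|tt|tt] := ltngtP t t'.
- by have := halted _ _ _ c' tt ct hc.
- by have := halted _ _ _ c tt ct' hc'.
- by move: ct'; rewrite -tt ct => -[->].
Qed.

Lemma countable_recursive : countable [set f | recursive f].
Proof.
apply/countable_injP.
have /choice[c cP] f : exists k, recursive f ->
    exists2 M, k = turing_machine_code M & forall n, tm_computes M n (f n).
  have [[M Mf]|nf] := pselect (recursive f); last by exists 0%N.
  by exists (turing_machine_code M) => _; exists M.
exists c => f g; rewrite !inE /= => /cP[M -> Mf] /cP[N -> Ng].
move=> /turing_machine_code_inj MN; rewrite -MN in Ng.
by apply/funext => n; exact: tm_computes_inj (Mf n) (Ng n).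
Qed.

Lemma countable_recursive_sn : countable [set f | recursive_sn f].
Proof.
pose F (g : nat -> nat) s n := g (pair_code (situation_code s, n)).
apply: sub_countable (_ : countable (F @` [set g | recursive g])).
  apply: subset_card_le => f [g [rg fg]]; exists g => //.
  by apply/funext => s; apply/funext => n; rewrite fg.
exact/(sub_countable (card_image_le _ _))/countable_recursive.
Qed.

(** A process is the limit of its rational approximations, so it is determined by the codes of four
    recursive maps: numerator, denominator, sign and modulus. *)
Lemma countable_computable_process (R : realType) :
  countable [set F : real_process R | computable_process F].
Proof.
have /countable_injP[c cinj] := countable_recursive_sn.
apply/countable_injP.
have /choice[k kP] (F : real_process R) : exists k : nat, computable_process F ->
    exists a b sg e, [/\ [/\ recursive_sn a, recursive_sn b, recursive_sn sg &
      recursive_sn e], k = pickle (c a, c b, c sg, c e) &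
      forall s N n, (e s N <= n)%N ->
        `|ratr ((-1) ^+ sg s n * ((a s n)%:R / (b s n)%:R)) - F s| <= 2 ^- N].
  have [cF|nF] := pselect (computable_process F); last by exists 0%N.
  have [r [e [[a [b [sg [ra rb rsg rE]]]] re rF]]] := cF.
  exists (pickle (c a, c b, c sg, c e)) => _; exists a, b, sg, e; split=> //.
  by move=> s N n /rF; have [_ ->] := rE s n.
exists k => F G; rewrite !inE /= => cF cG.
have [a [b [sg [e [[ra rb rsg re] -> rF]]]]] := kP _ cF.
have [a' [b' [sg' [e' [[ra' rb' rsg' re'] -> rG]]]]] := kP _ cG.
move=> /(pcan_inj (@pickleK _))[] ea eb esg ee.
have {}ea := cinj _ _ (mem_set ra) (mem_set ra') ea.
have {}eb := cinj _ _ (mem_set rb) (mem_set rb') eb.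
have {}esg := cinj _ _ (mem_set rsg) (mem_set rsg') esg.
have {}ee := cinj _ _ (mem_set re) (mem_set re') ee.
move: ea eb esg ee rF rG => <- <- <- <- rF rG.
apply/funext => s; apply/eqP; rewrite -subr_eq0 -normr_le0.
apply/ler_addgt0Pr => eps eps0; rewrite add0r.
(* This choice gives [2 / eps < N < 2 ^ N], which leaves room for two errors of size [2 ^- N]. *)
pose N := (Num.truncn (2 / eps)).+1.
have lt2N : 2 * 2 ^- N < eps.
  rewrite ltr_pdivrMr ?exprn_gt0 // mulrC -ltr_pdivrMr //.
  apply: lt_trans (truncnS_gt _) _.
  by rewrite -natrX ltr_nat ltn_expl.
(* Both processes now share approximations and modulus, so the same [x] is within [2 ^- N] of [F s]
   and of [G s]. *)
set n := e s N; set x := ratr ((-1) ^+ sg s n * ((a s n)%:R / (b s n)%:R)) : R.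
apply: le_trans (ltW lt2N); rewrite mulr_natl mulr2n.
rewrite (_ : F s - G s = (x - G s) - (x - F s)); last first.
  by rewrite opprB [RHS]addrC subrKA.
by apply: le_trans (ler_normB _ _) _; apply: lerD; [exact: rG|exact: rF].
Qed.

(** * Schnorr randomness as a consequence of boundedness *)

Lemma schnorr_random_of_random {R : realType} (phi : forecasting_system R) w :
  random [set F : real_process R | computable_process F] phi w ->
  schnorr_random phi w.
Proof.
move=> rw T rho cT testT [_ rho_nd rho_unb].
apply: limn_esup_le.
have [B TB] : exists B : R, forall n, (1 <= n)%N -> along T w n <= B.
  apply: contrapT => /forallNP unb.
  apply: (not_randomP _ phi w).2 rw; exists T; split=> // B.
  have /existsNP[n /not_implyP[n1 /negP]] := unb B.
  by rewrite -ltNge; exists n.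
have [m Bm] := rho_unb (Num.truncn B).+1.
(* From [m] on, [rho] exceeds [B]; starting at [m.+1] also makes [n] positive, as the bound [TB]
   requires. *)
exists m.+1 => // n /= mn; rewrite lee_fin subr_le0.
apply: le_trans (TB n _) _; first exact: leq_ltn_trans mn.
apply: le_trans (ltW (truncnS_gt B)) _.
by rewrite ler_nat ltnW // (leq_trans Bm) // rho_nd // ltnW.
Qed.

Theorem theorem19 (R : realType) (phi : forecasting_system R) :
  (forall AA : set (real_process R), allowable AA ->
     upper_probability phi [set w : binary_path | ~ random AA phi w] = 0%E) /\
  upper_probability phi [set w : binary_path | ~ schnorr_random phi w] = 0%E.
Proof.
split=> [AA [countA _ _]|]; first exact: upper_probability_nonrandom.
apply/eqP; rewrite eq_le upper_probability_ge0 andbT.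
(* The paths that are not Schnorr random lie in the null event of paths not random for the countable
   set of all computable processes. *)
rewrite -(upper_probability_nonrandom phi _ (countable_computable_process R)).
by apply: le_upper_probability => w /= + rw; apply; exact: schnorr_random_of_random.
Qed.
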